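(* Let $N\ge 1$, $0\le r\le N$, and $\lambda=(\lambda_1,\dots,\lambda_N)$ with $\lambda_1\ge\lambda_2\ge\dots\ge\lambda_N\ge 0$. Assume $g\in C^{2,2,mix}$, and let $u$ be the solution of $$\frac{\partial u}{\partial t}=\sum_{k=1}^N\lambda_k\frac{\partial^2u}{\partial z_k^2}\quad (z\in\mathbb{R}^N,\ t\in(0,T)),\qquad u(z,0)=g(z).$$ Let $u_{r,1}=(1+r-N)\,u^{\{1,\dots,r\}}+\sum_{k=r+1}^N u^{\{1,\dots,r,k\}}$ be the first order expansion and $\hat u_{r,1}$ its expansion error, i.e. the difference between $u_{r,1}$ and $u$. Then for all $t\in(0,T)$ $$\left\|\hat u_{r,1}(\cdot,t)\right\|_\infty\le t^2\sum_{r<i<k\le N}\lambda_k\lambda_i\left\|\frac{\partial^4 g}{\partial z_k^2\partial z_i^2}\right\|_\infty .$$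
   Context: $C^b$ is the set of bounded continuous functions $\mathbb{R}^N\to\mathbb{R}$. $C^{j,k,mix}=\{g\in C^b:\ \partial_{i_1}^j\cdots\partial_{i_k}^j g\in C^b\ \text{for all } 1\le i_1<\dots<i_k\le N\}$; thus $g\in C^{2,2,mix}$ means $g\in C^b$ and $\partial_{i_1}^2\partial_{i_2}^2 g\in C^b$ for all $1\le i_1<i_2\le N$. For an index set $\nu\subseteq\{1,\dots,N\}$, $u^\nu$ denotes the solution of $\partial_t u^\nu=\sum_{k\in\nu}\lambda_k\partial_{z_k}^2u^\nu$, $u^\nu(\cdot,0)=g$, on $\mathbb{R}^N\times(0,T)$; in particular $u=u^{\{1,\dots,N\}}$. Solutions are the ones given by the Green's function representation $$u^\nu(z,t)=\int_{\mathbb{R}^N}\Phi^\nu(y,t)\,g(z-y)\,dy,\qquad \Phi^\nu(y,t)=\prod_{k\in\nu}\frac{\exp(-y_k^2/(4\lambda_kt))}{\sqrt{4\pi\lambda_kt}}\prod_{k\notin\nu}\delta(y_k),$$ where $\delta$ is the Dirac delta (no integration in that coordinate); a factor with $k\in\nu$, $\lambda_k=0$ is also read as $\delta(y_k)$. For $r=0$, $\{1,\dots,r\}=\emptyset$. $\|\cdot\|_\infty$ is the supremum norm over $\mathbb{R}^N$. *)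

(* Defs.v *)
From HB Require Import structures.
From mathcomp Require Import all_boot all_order all_algebra.
From mathcomp Require Import ring.
From mathcomp Require Import all_classical all_reals all_analysis.
Import Order.TTheory GRing.Theory Num.Theory.
Import numFieldNormedType.Exports.

Set Implicit Arguments.
Unset Strict Implicit.
Unset Printing Implicit Defensive.

Local Open Scope classical_set_scope.
Local Open Scope ring_scope.

Section Regularity.
Context {R : realType} {N : nat}.
Implicit Types (g : 'rV[R]_N -> R) (i k : 'I_N) (s : seq 'I_N).

Definition bounded_continuous g :=
  continuous g /\ [bounded g z | z in [set: 'rV[R]_N]].

Definition pderive k g : 'rV[R]_N -> R := 'D_(delta_mx 0 k) g.

(* The head of s is the outermost derivative:
   pderives [:: i; k] g = d/dz_i (d/dz_k g). *)
Definition pderives s g : 'rV[R]_N -> R := foldr pderive g s.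

(* 'D_v is total; every derivative taken along s is required to exist. *)
Fixpoint pderivable s g : Prop :=
  if s is k :: s' then
    pderivable s' g /\ forall z, derivable (pderives s' g) z (delta_mx 0 k)
  else True.

(* C^{j,m,mix}: for i_1 < ... < i_m, the iterated derivative
   d_{i_1}^j ... d_{i_m}^j g exists (d_{i_m} is taken first) and lies in C^b.
   No regularity of the intermediate derivatives is required. *)
Definition Cmix (j m : nat) g :=
  bounded_continuous g /\
  forall I : m.-tuple 'I_N, sorted (fun i k => (i < k)%N) I ->
    let s := flatten [seq nseq j i | i <- I] in
    pderivable s g /\ bounded_continuous (pderives s g).

(* Extended-real valued, so that an unbounded function has norm +oo. *)
Definition supnorm g : \bar R :=
  ereal_sup [set `|g z|%:E | z in [set: 'rV[R]_N]].

End Regularity.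

Section HeatSolution.
Context {R : realType}.

(* The product measure mu_0 x ... x mu_(n-1) on R^n; see tuple_prod_box. *)
Fixpoint tuple_prod (n : nat) :
    ('I_n -> set R -> \bar R) -> set (n.-tuple R) -> \bar R :=
  match n with
  | 0 => fun _ => dirac ([tuple] : 0.-tuple R)
  | n'.+1 => fun mu =>
      pushforward (mu ord0 \x tuple_prod (fun i => mu (lift ord0 i)))%E
        (fun p : R * n'.-tuple R => [tuple of p.1 :: p.2])
  end.

Lemma tuple_prod_box n (P : 'I_n -> probability R R) :
  exists Q : probability (n.-tuple R) R,
    (tuple_prod P = Q) /\
    forall A : 'I_n -> set R, (forall i, measurable (A i)) ->
      Q [set y | forall i, A i (tnth y i)] = (\prod_(i < n) P i (A i))%E.
Proof.
elim: n P => [|n IH] P.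
  exists (dirac ([tuple] : 0.-tuple R) : probability _ R); split => // A mA.
  rewrite big_ord0 /= /dirac indicE mem_set//=; by case.
have [Q [QE Qbox]] := IH (fun i => P (lift ord0 i)).
pose f : R * n.-tuple R -> n.+1.-tuple R := fun p => [tuple of p.1 :: p.2].
have mf : measurable_fun setT f by apply: measurable_cons.
pose F : {mfun _ >-> _} := HB.pack f (isMeasurableFun.Build _ _ _ _ f mf).
pose PQ : probability (R * n.-tuple R)%type R := (P ord0 \x Q)%E.
exists (distribution PQ F); split.
  by rewrite /= QE.
move=> A mA; rewrite /distribution /pushforward /= big_ord_recl -Qbox //.
rewrite -product_measure1E//; last first.
  rewrite (_ : [set _ | _] =
      \big[setI/setT]_(i < n) ((fun y => tnth y i) @^-1` A (lift ord0 i))).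
    apply: bigsetI_measurable => i _.
    by rewrite -[X in measurable X]setTI; exact: measurable_tnth.
  rewrite -bigcap_seq; apply/seteqP; split => y /= h i => [_|]; first exact: h.
  by apply: h; rewrite /= mem_index_enum.
congr ((_ \x _)%E _).
apply/seteqP; split => -[x y] /=.
  move=> h; split; first by have := h ord0.
  by move=> i; have := h (lift ord0 i); rewrite tnthS.
move=> [h0 h] i; case: (unliftP ord0 i) => [j ->|->]; rewrite ?tnthS//=.
Qed.

Definition heat_kernel (l t y : R) : R :=
  expR (- (y ^+ 2 / (4 * l * t))) / Num.sqrt (4 * pi * l * t).

Context {N : nat}.
Implicit Types (nu : {set 'I_N}) (lambda : 'I_N -> R) (g : 'rV[R]_N -> R).

(* The k-th factor of Phi^nu(y, t) dy: a Gaussian density, or the Dirac mass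
   at 0 when k is not in nu or lambda_k = 0. *)
Definition green_factor nu lambda (t : R) (k : 'I_N) : set R -> \bar R :=
  if (k \in nu) && (lambda k != 0)
  then fun A => (\int[lebesgue_measure]_(y in A) (heat_kernel (lambda k) t y)%:E)%E
  else dirac (0 : R).

Lemma green_factor_normal nu lambda (t : R) k :
  0 < t -> 0 <= lambda k ->
  green_factor nu lambda t k =
  if (k \in nu) && (lambda k != 0) then normal_prob 0 (Num.sqrt (2 * lambda k * t)) else dirac (0:R).
Proof.
move=> t0 l0; rewrite /green_factor; case: ifP => // /andP[_ lk].
have lp : 0 < lambda k by rewrite lt_def lk.
apply/funext => A; rewrite /normal_prob; congr (integral _ _ _).
apply/funext => y; congr EFin.
have s0 : 0 < 2 * lambda k * t by rewrite !mulr_gt0.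
rewrite normal_pdfE ?gt_eqF ?sqrtr_gt0// /normal_peak /normal_fun /heat_kernel.
rewrite mulrC sqr_sqrtr ?ltW// subr0.
congr (_^-1 * expR _). congr Num.sqrt; ring.
rewrite -mulNr; congr (_ / _); ring.
Qed.

(* The measure Phi^nu(y, t) dy on R^N. *)
Definition green nu lambda (t : R) : set (N.-tuple R) -> \bar R :=
  tuple_prod (green_factor nu lambda t).

(* u^nu(z, t) = \int Phi^nu(y, t) g(z - y) dy *)
Definition heat_sol lambda g nu (z : 'rV[R]_N) (t : R) : R :=
  fine (\int[green nu lambda t]_y (g (z - \row_k tnth y k))%:E)%E.

(* u_{r,1}; the coordinates 1..N are numbered from 0, so {1, ..., r} is
   {k | k < r} and the sum over k = r+1..N is over r <= k. *)
Definition expansion1 lambda g (r : nat) (z : 'rV[R]_N) (t : R) : R :=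
  let nu := [set k : 'I_N | (k < r)%N]%SET in
  (1 + r%:R - N%:R) * heat_sol lambda g nu z t +
  \sum_(k < N | (r <= k)%N) heat_sol lambda g (nu :|: [set k])%SET z t.

End HeatSolution.

(* Main.v *)
From HB Require Import structures.
Require Import Defs.
From mathcomp Require Import all_boot all_order all_algebra.
From mathcomp Require Import all_classical all_reals all_analysis.
From mathcomp Require Import measurable_realfun.
From mathcomp Require Import ring lra.
Import Order.TTheory GRing.Theory Num.Theory.
Import numFieldNormedType.Exports.
Local Open Scope ring_scope.

(** Write [U A] for the solution at [(z, t)] in which only the coordinates of
    [A] diffuse, and [lo m] for the set of coordinates [j < m].  Telescoping
    (lemma [telescope_expansion1]) turns the expansion error into minus the sum,
    over [r <= i < k], of the mixed differences
    [U (lo i + i + k) - U (lo i + k) - U (lo i + i) + U (lo i)],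
    so it suffices to bound each of these by
    [t^2 lambda_i lambda_k sup |d_i^2 d_k^2 g|] (lemma [mixed_difference_le]).

    All four solutions are expressed by one measure, the product [Q] of the
    Gaussian laws of all coordinates: if [|c_k|] is the indicator of
    [k \in A], then [U A] is the integral of [g (z - c y)] against [Q(dy)],
    where [c y] is the coordinatewise product (lemma [heat_sol_scale]).  Indeed
    a zero coefficient collapses a Gaussian factor to the Dirac mass, and a sign
    leaves it unchanged.  Averaging over the signs of the coefficients of [i]
    and [k] shows that four times the mixed difference is the [Q]-integral of a
    double second difference of [g], with steps [y_i] and [y_k].

    A second difference with step [y] of a function whose second derivative is
    bounded by [M] is at most [M y^2] (lemma [second_diff_le]).  Applying this
    along [k] and then along [i] bounds the double difference by
    [sup |d_i^2 d_k^2 g| y_i^2 y_k^2] (lemma [second_diff2_le]); only the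
    existence of the intermediate derivatives is used, never their continuity.
    The integral of [y_i^2 y_k^2] factorizes, and the second moment of the
    [k]-th law is at most [2 lambda_k t].  The latter is derived from the
    normalization of the Gaussian densities alone: for [s < tau], the inequality
    [1 + x <= exp x] compares [(1 + eps y^2)] times the density of variance
    [s^2] with [tau / s] times the density of variance [tau^2], and then [tau]
    tends to [s]. *)

Local Open Scope classical_set_scope.

(** * Second differences *)

(** The symmetric second difference of [f] at [0] with step [y]. *)
Definition second_diff {R : realType} (f : R -> R) (y : R) : R :=
  f y - 2 * f 0 + f (- y).

Lemma ler_dist_MVT {R : realType} {f df : R -> R} {M a b : R} :
  (forall x : R, is_derive x (1 : R) f (df x)) -> (forall x, `|df x| <= M) ->
  a <= b -> `|f b - f a| <= M * (b - a).
Proof.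
move=> fdf dfM ab.
have [|c _ ->] := MVT_segment (f := f) (df := df) ab.
  apply: derivable_within_continuous => x _; by have [] := fdf x.
by rewrite normrM (ger0_norm (x := b - a)) ?subr_ge0// ler_wpM2r ?subr_ge0.
Qed.

(** The constant [M] is sharp; no continuity of [ddf] is needed, since only the
    mean value theorem is applied. *)
Lemma second_diff_le {R : realType} {f df ddf : R -> R} {M : R} :
  (forall x : R, is_derive x (1 : R) f (df x)) ->
  (forall x : R, is_derive x (1 : R) df (ddf x)) ->
  (forall x, `|ddf x| <= M) -> forall y, `|second_diff f y| <= M * y ^+ 2.
Proof.
move=> fdf dfddf ddfM y.
wlog y0 : y / 0 <= y.
  move=> H; have [/H//|/ltW y0] := leP 0 y.
  have := H (- y); rewrite oppr_ge0 sqrrN => /(_ y0).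
  by congr (`|_| <= _); rewrite /second_diff opprK; ring.
have key (e : R) : `|e| = 1 -> e * second_diff f y <= M * y ^+ 2.
  move=> e1.
  (* The claim is [h 0 <= h y], and [h] is nondecreasing on [0, y]: its derivative
     is nonnegative there because [df] is [M]-Lipschitz. *)
  pose h s := M * s ^+ 2 - e * (f s + f (- s)).
  pose dh s := M * (2 * s) - e * (df s - df (- s)).
  have hdh x : is_derive x (1 : R) h (dh x).
    have fN : is_derive x (1 : R) (f \o -%R) (- df (- x)).
      rewrite -mulrN1.
      exact: (is_derive1_comp (fdf (- x)) (is_deriveNid x (1 : R))).
    rewrite /h; apply: is_derive_eq.
    rewrite /dh /GRing.scale/=; ring.
  have [|c c0 hc] := MVT_segment (f := h) (df := dh) y0.
    by apply: derivable_within_continuous => x _; by have [] := hdh x.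
  have {}c0 : 0 <= c by move: c0; rewrite in_itv/= => /andP[].
  have dfc : `|df c - df (- c)| <= M * (2 * c).
    apply: le_trans (ler_dist_MVT dfddf ddfM _) _; first lra.
    by rewrite opprK mulr2n mulrDl !mul1r.
  have : 0 <= dh c.
    rewrite subr_ge0; apply: le_trans dfc; apply: le_trans (ler_norm _) _.
    by rewrite normrM e1 mul1r.
  move=> /(mulr_ge0)/(_ y0); rewrite -[y in _ * y]subr0 -hc.
  rewrite /h /second_diff oppr0 expr0n/=; lra.
rewrite ler_norml; apply/andP; split.
  by rewrite lerNl -mulN1r key// normrN1.
by rewrite -[leLHS]mul1r key// normr1.
Qed.

Lemma is_derive_line {R : realType} {V : normedModType R} {g : V -> R} {z v : V}
    {s : R} : derivable g (z + s *: v) v ->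
  is_derive s (1 : R) (fun s => g (z + s *: v)) ('D_v g (z + s *: v)).
Proof.
move=> gv.
have E : (fun h : R => h^-1 *: (g (z + (h *: (1 : R) + s) *: v) - g (z + s *: v)))
    = (fun h : R => h^-1 *: (g (h *: v + (z + s *: v)) - g (z + s *: v))).
  apply/funext => h; congr (_ *: (g _ - _)).
  by rewrite [h *: _]mulr1 scalerDl addrCA.
apply: DeriveDef; first by rewrite /derivable /= E.
by rewrite /derive /= E.
Qed.

(** The double second difference, first bounded along [k] in terms of the second
    difference of [d_k^2 g] along [i], and the latter by [d_i^2 d_k^2 g]. *)
Lemma second_diff2_le {R : realType} {N : nat} {g : 'rV[R]_N -> R} {i k : 'I_N}
    {M : R} : pderivable [:: i; i; k; k] g ->
  (forall z, `|pderives [:: i; i; k; k] g z| <= M) ->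
  forall z x y, `|second_diff (fun a => second_diff (fun b =>
     g (z + a *: delta_mx 0 k + b *: delta_mx 0 i)) y) x| <= M * y ^+ 2 * x ^+ 2.
Proof.
move=> /= [[[[_ d1] d2] d3] d4] gM z x y.
pose D f := fun a => second_diff (fun b : R =>
     f (z + a *: delta_mx 0 k + b *: delta_mx 0 i) : R) y.
have DE f : (forall z, derivable f z (delta_mx 0 k)) ->
    forall a : R, is_derive a (1 : R) (D f) (D (pderive k f) a).
  move=> fd a.
  have fab b : is_derive a (1 : R)
      (fun a => f (z + a *: delta_mx 0 k + b *: delta_mx 0 i))
      (pderive k f (z + a *: delta_mx 0 k + b *: delta_mx 0 i)).
    rewrite (_ : (fun a => _) = (fun a => f (z + b *: delta_mx 0 i + a *: delta_mx 0 k))).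
      by rewrite addrAC; exact: is_derive_line.
    by apply/funext => a'; rewrite addrAC.
  rewrite /D /second_diff.
  apply: is_derive_eq.
  by rewrite /GRing.scale/=; ring.
apply: (second_diff_le (f := D g) (DE _ d1) (DE _ d2)) => a.
apply: (second_diff_le (fun b => is_derive_line (d3 _))
  (fun b => is_derive_line (d4 _))) => b.
exact: gM.
Qed.

(** * Integration against a finite product of probabilities *)

(** Tonelli's theorem for the first coordinate. *)
Lemma ge0_integral_tuple_prodS {R : realType} {n : nat}
    (P : 'I_n.+1 -> probability R R) (Q : probability (n.-tuple R) R)
    (F : n.+1.-tuple R -> \bar R) :
  tuple_prod (fun i => P (lift ord0 i)) = Q ->
  measurable_fun setT F -> (forall y, 0 <= F y)%E ->
  (\int[tuple_prod P]_y F y =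
   \int[P ord0]_x \int[Q]_y F [tuple of x :: y])%E.
Proof.
move=> QE mF F0 /=; rewrite QE.
have mc : measurable_fun setT (fun p : R * n.-tuple R => [tuple of p.1 :: p.2]).
  exact: measurable_cons.
rewrite (ge0_integral_pushforward mc (P ord0 \x Q)%E)//.
rewrite preimage_setT fubini_tonelli1//; last by move=> x; exact: F0.
exact: (measurableT_comp mF mc).
Qed.

Lemma measurable_integral_cons {R : realType} {n : nat}
    (Q : probability (n.-tuple R) R) (F : n.+1.-tuple R -> \bar R) :
  measurable_fun setT F -> (forall y, 0 <= F y)%E ->
  measurable_fun setT (fun x => \int[Q]_y F [tuple of x :: y])%E.
Proof.
move=> mF F0.
have mc : measurable_fun setT (fun p : R * n.-tuple R => [tuple of p.1 :: p.2]).
  exact: measurable_cons.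
apply: (measurable_fun_fubini_tonelli_F (m2 := Q)
  (fun p : R * n.-tuple R => F [tuple of p.1 :: p.2])) => //.
exact: (measurableT_comp mF mc).
Qed.

Lemma measurable_tuple_map {R : realType} {n : nat} (f : 'I_n -> R -> R) :
  (forall i, measurable_fun setT (f i)) ->
  measurable_fun setT (fun y : n.-tuple R => [tuple f i (tnth y i) | i < n]).
Proof.
move=> mf; apply/measurable_fun_tnthP => i.
rewrite (_ : _ \o _ = f i \o (fun y => tnth y i)); last first.
  by apply/funext => y /=; rewrite tnth_mktuple.
by apply: measurableT_comp => //; exact: measurable_tnth.
Qed.

(** Change of variables: the image of a product of laws under a coordinatewise map
    is the product of the image laws. *)
Lemma ge0_integral_tuple_prod_map {R : realType} {n : nat}
    (P P' : 'I_n -> probability R R) (f : 'I_n -> R -> R)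
    (F : n.-tuple R -> \bar R) :
  (forall i, measurable_fun setT (f i)) ->
  (forall i A, measurable A -> P' i A = P i (f i @^-1` A)) ->
  measurable_fun setT F -> (forall y, 0 <= F y)%E ->
  (\int[tuple_prod P']_y F y =
   \int[tuple_prod P]_y F [tuple f i (tnth y i) | i < n])%E.
Proof.
elim: n P P' f F => [|n IH] P P' f F mf P'E mF F0.
  by apply: eq_integral => y _; congr F; apply: eq_from_tnth => -[].
have [Q [QE _]] := tuple_prod_box (fun i => P (lift ord0 i)).
have [Q' [Q'E _]] := tuple_prod_box (fun i => P' (lift ord0 i)).
have mmap := measurable_tuple_map f mf.
rewrite (ge0_integral_tuple_prodS _ _ _ Q'E)//.
rewrite (ge0_integral_tuple_prodS _ _ _ QE)//; last exact: measurableT_comp.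
have -> : (\int[P' ord0]_x \int[Q']_y F [tuple of x :: y] =
    \int[pushforward (P ord0) (f ord0)]_x \int[Q']_y F [tuple of x :: y])%E.
  by apply: eq_measure_integral => A mA _; exact: P'E.
rewrite ge0_integral_pushforward//; last 2 first.
- exact: measurable_integral_cons.
- by move=> x _; exact: integral_ge0.
rewrite preimage_setT; apply: eq_integral => x _ /=.
rewrite -Q'E.
rewrite (IH (fun i => P (lift ord0 i)) _ (fun i => f (lift ord0 i)))//.
- rewrite (QE : tuple_prod (fun i : 'I_n => P (lift ord0 i)) = Q).
  apply: eq_integral => y _; congr F; apply: eq_from_tnth => i.
  rewrite tnth_mktuple; case: (unliftP ord0 i) => [j ->|->] //.
  by rewrite !tnthS !tnth_mktuple.
- by move=> i A mA; exact: P'E.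
- by apply: measurableT_comp => //; exact: measurable_cons.
Qed.

Lemma integral_tuple_prod_map {R : realType} {n : nat}
    (P P' : 'I_n -> probability R R) (f : 'I_n -> R -> R)
    (F : n.-tuple R -> \bar R) :
  (forall i, measurable_fun setT (f i)) ->
  (forall i A, measurable A -> P' i A = P i (f i @^-1` A)) ->
  measurable_fun setT F ->
  (\int[tuple_prod P']_y F y =
   \int[tuple_prod P]_y F [tuple f i (tnth y i) | i < n])%E.
Proof.
move=> mf P'E mF.
have pos G (mG : measurable_fun setT G) (G0 : forall y, (0 <= G y)%E) :=
  ge0_integral_tuple_prod_map P P' f G mf P'E mG G0.
have [Q [QE _]] := tuple_prod_box P; have [Q' [Q'E _]] := tuple_prod_box P'.
move: pos; rewrite QE Q'E => pos.
rewrite integralE [RHS]integralE; congr (_ - _)%E.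
- rewrite [LHS]pos//; last exact: measurable_funepos.
  by apply: eq_integral => y _; rewrite !funeposE.
- rewrite [LHS]pos//; last exact: measurable_funeneg.
  by apply: eq_integral => y _; rewrite !funenegE.
Qed.

Lemma ge0_integral_tuple_prod_prod {R : realType} {n : nat}
    (P : 'I_n -> probability R R) (h : 'I_n -> R -> R) :
  (forall i, measurable_fun setT (h i)) -> (forall i x, 0 <= h i x) ->
  (\int[tuple_prod P]_y (\prod_(i < n) h i (tnth y i))%:E =
   \prod_(i < n) \int[P i]_x (h i x)%:E)%E.
Proof.
elim: n P h => [|n IH] P h mh h0.
  rewrite big_ord0; under eq_integral do rewrite big_ord0.
  by rewrite /= integral_cst// mul1e /= diracT.
have [Q [QE _]] := tuple_prod_box (fun i => P (lift ord0 i)).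
have mprod m (h' : 'I_m -> R -> R) : (forall i, measurable_fun setT (h' i)) ->
    measurable_fun setT (fun y : m.-tuple R => \prod_(i < m) h' i (tnth y i)).
  move=> mh'; apply: measurable_prod => i _.
  by apply: measurableT_comp => //; exact: measurable_tnth.
rewrite (ge0_integral_tuple_prodS _ _ _ QE)//; last 2 first.
- by apply/measurable_EFinP; exact: mprod.
- by move=> y; rewrite lee_fin prodr_ge0.
rewrite big_ord_recl -(IH (fun i => P (lift ord0 i)))// QE.
rewrite -ge0_integralZr//; last 3 first.
- exact/measurable_EFinP.
- by move=> x _; rewrite lee_fin.
- by apply: integral_ge0 => y _; rewrite lee_fin prodr_ge0.
apply: eq_integral => x _.
rewrite -ge0_integralZl//.
- apply: eq_integral => y _; rewrite big_ord_recl /= EFinM; congr (_ * _%:E)%E.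
  by apply: eq_bigr => i _; rewrite tnthS.
- by apply/measurable_EFinP; exact: (mprod n (fun i => h (lift ord0 i))).
- by move=> y _; rewrite lee_fin prodr_ge0.
- by rewrite lee_fin.
Qed.

(** * Symmetry and second moment of the centred normal law *)

Lemma normal_pdfN {R : realType} (s x : R) : s != 0 ->
  normal_pdf 0 s (- x) = normal_pdf 0 s x.
Proof. by move=> s0; rewrite normal_pdfE// /normal_fun !subr0 sqrrN. Qed.

Lemma normal_prob_opp {R : realType} (s : R) (A : set R) : s != 0 ->
  measurable A -> normal_prob 0 s (-%R @^-1` A) = normal_prob 0 s A.
Proof.
move=> s0 mA; rewrite /normal_prob.
under eq_integral do rewrite -normal_pdfN//.
rewrite -[LHS](ge0_integral_pushforward
  (phi := -%R : measurableTypeR R -> measurableTypeR R)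
  _ (@lebesgue_measure R) (f := fun x => (normal_pdf 0 s x)%:E))//=.
- by apply: eq_measure_integral => B mB _; exact: lebesgue_measureN.
- by apply: measurable_funTS; apply/measurable_EFinP; exact: measurable_normal_pdf.
- by move=> y _; rewrite lee_fin normal_pdf_ge0.
Qed.

Section density.
Import HBNNSimple.

(** Integration against a measure [nu] of density [p] with respect to [mu]. *)
Lemma ge0_integral_density {d} {T : measurableType d} {R : realType}
    (mu nu : {measure set T -> \bar R}) (p : T -> R) (f : T -> \bar R) :
  measurable_fun setT p -> (forall x, 0 <= p x) ->
  (forall A, measurable A -> nu A = \int[mu]_(x in A) (p x)%:E)%E ->
  measurable_fun setT f -> (forall x, 0 <= f x)%E ->
  (\int[nu]_x f x = \int[mu]_x (f x * (p x)%:E))%E.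
Proof.
move=> mp p0 nuE mf f0.
pose h := nnsfun_approx measurableT mf.
have mpE : measurable_fun setT (EFin \o p) by exact/measurable_EFinP.
have -> : (\int[nu]_x f x = limn (fun n => \int[nu]_x (h n x)%:E))%E.
  rewrite -monotone_convergence//.
  - apply: eq_integral => x _; apply/esym/cvg_lim => //.
    exact: cvg_nnsfun_approx.
  - by move=> n; exact/measurable_EFinP/measurable_funP.
  - by move=> n y _; rewrite lee_fin.
  - by move=> y _ m n mn; rewrite lee_fin; exact/lefP/nd_nnsfun_approx.
have -> : (\int[mu]_x (f x * (p x)%:E) =
    limn (fun n => \int[mu]_x ((h n x)%:E * (p x)%:E)))%E.
  rewrite -monotone_convergence//.
  - apply: eq_integral => x _; apply/esym/cvg_lim => //.
    by apply: cvgeZr => //; exact: cvg_nnsfun_approx.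
  - move=> n; apply: emeasurable_funM => //.
    exact/measurable_EFinP/measurable_funP.
  - by move=> n y _; rewrite mule_ge0// lee_fin.
  - move=> y _ m n mn; rewrite lee_wpmul2r ?lee_fin//.
    exact/lefP/nd_nnsfun_approx.
congr (limn _); apply/funext => n.
transitivity (\int[nu]_x
  (\sum_(y \in range (h n)) (y * \1_(h n @^-1` [set y]) x)%:E))%E.
  by apply: eq_integral => x _; rewrite /= fimfunE -fsumEFin.
rewrite ge0_integral_fsum//; last 2 first.
- by move=> r; exact/measurable_EFinP/measurable_funM.
- by move=> r x _; rewrite nnfun_muleindic_ge0.
transitivity (\int[mu]_x
  (\sum_(y \in range (h n)) (y * \1_(h n @^-1` [set y]) x)%:E * (p x)%:E))%E; last first.
  apply: eq_integral => x _; rewrite /= fimfunE -fsumEFin// ge0_mule_fsuml//.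
  by move=> r; rewrite nnfun_muleindic_ge0.
rewrite ge0_integral_fsum//; last 2 first.
- move=> r; apply: emeasurable_funM => //.
  exact/measurable_EFinP/measurable_funM.
- by move=> r x _; rewrite mule_ge0 ?nnfun_muleindic_ge0 ?lee_fin.
apply: eq_fsbigr => r /[!inE] -[x _ hxr].
have r0 : 0 <= r by rewrite -hxr.
rewrite integralZl_indic_nnsfun//= integral_indic// setIT nuE//.
under [RHS]eq_integral do rewrite EFinM -muleA.
rewrite ge0_integralZl//.
- congr (_ * _)%E; rewrite integral_mkcond; apply: eq_integral => z _.
  by rewrite patchE indicE; case: ifPn; rewrite ?mul1e ?mul0e.
- by apply: emeasurable_funM => //; exact/measurable_EFinP.
- by move=> z _; rewrite mule_ge0 ?lee_fin.
Qed.

End density.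

(** Comparison of two normal densities, from [1 + x <= expR x] applied to
    [x = (s^-2 - tau^-2) / 2 * y^2]. *)
Lemma normal_pdf_sqr_le {R : realType} (s tau y : R) : 0 < s -> s < tau ->
  (1 + (s ^- 2 - tau ^- 2) / 2 * y ^+ 2) * normal_pdf 0 s y
  <= tau / s * normal_pdf 0 tau y.
Proof.
move=> s0 st; have t0 := lt_trans s0 st.
rewrite !normal_pdfE ?gt_eqF// /normal_fun !subr0 /normal_peak.
pose c : R := Num.sqrt (pi *+ 2).
have peakE (r : R) : 0 < r -> Num.sqrt (r ^+ 2 * pi *+ 2) = r * c.
  by move=> r0; rewrite -(mulrnAr (r ^+ 2)) sqrtrM ?sqr_ge0// sqrtr_sqr gtr0_norm.
rewrite !peakE//.
have c0 : 0 < c by rewrite sqrtr_gt0 pmulrn_rgt0// pi_gt0.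
rewrite !(invfM _ c) (mulrA (tau / s)) [tau / s * _]mulrA.
rewrite [tau / s / tau]mulrAC divff ?gt_eqF// mul1r.
rewrite mulrCA ler_pM2l ?mulr_gt0 ?invr_gt0//.
rewrite (_ : - y ^+ 2 / (tau ^+ 2 *+ 2) =
    (s ^- 2 - tau ^- 2) / 2 * y ^+ 2 + - y ^+ 2 / (s ^+ 2 *+ 2)).
  rewrite expRD ler_pM2r ?expR_gt0// expR_ge1Dx//.
by field; rewrite ?lt0r_neq0.
Qed.

(** Integrating [normal_pdf_sqr_le] gives [1 + eps m <= tau / s] for the second
    moment [m], hence [m <= tau^2] for all [tau > s]. *)
Lemma normal_prob_second_moment_le {R : realType} (s : R) : 0 < s ->
  (\int[normal_prob 0 s]_y (y ^+ 2)%:E <= (s ^+ 2)%:E)%E.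
Proof.
move=> s0.
have m2 : measurable_fun setT (fun y : R => y ^+ 2) by exact: measurable_funX.
have mp r := @measurable_normal_pdf R 0 r.
rewrite (ge0_integral_density (@lebesgue_measure R) _ (normal_pdf 0 s))//; last 4 first.
- exact: mp.
- by move=> x; exact: normal_pdf_ge0.
- exact/measurable_EFinP.
- by move=> x; rewrite lee_fin sqr_ge0.
set m := integral _ _ _.
have m0 : (0 <= m)%E.
  by apply: integral_ge0 => y _; rewrite lee_fin mulr_ge0 ?sqr_ge0 ?normal_pdf_ge0.
apply/lee_addgt0Pr => e e0.
(* [tau] is chosen so that the bound [m <= tau^2] reads [m <= s^2 + e]. *)
pose tau := Num.sqrt (s ^+ 2 + e).
have tau2 : tau ^+ 2 = s ^+ 2 + e by rewrite sqr_sqrtr// ltW// addr_gt0 ?exprn_gt0.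
have st : s < tau by rewrite -ltr_sqr ?nnegrE ?sqrtr_ge0 ?ltW// tau2 ltrDl.
have t0 := lt_trans s0 st.
pose eps := (s ^- 2 - tau ^- 2) / 2.
have eps0 : 0 < eps.
  by rewrite divr_gt0// subr_gt0 ltf_pV2 ?posrE ?exprn_gt0// ltr_sqr ?nnegrE ?ltW.
have : (1 + eps%:E * m <= (tau / s)%:E)%E.
  rewrite -[leRHS]mule1 -[X in (_ <= _ * X)%E](integral_normal_pdf 0 tau).
  rewrite -[X in (X + _)%E](integral_normal_pdf 0 s).
  have pm r : measurable_fun setT (fun y : R => (normal_pdf 0 r y)%:E).
    exact/measurable_EFinP.
  have p0 r (y : R) : (0 <= (normal_pdf 0 r y)%:E)%E.
    by rewrite lee_fin normal_pdf_ge0.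
  have qm : measurable_fun setT (fun y : R => (y ^+ 2)%:E * (normal_pdf 0 s y)%:E)%E.
    by apply: emeasurable_funM => //; exact/measurable_EFinP.
  have q0 (y : R) : (0 <= (y ^+ 2)%:E * (normal_pdf 0 s y)%:E)%E.
    by rewrite mule_ge0// lee_fin sqr_ge0.
  have mcq : measurable_fun setT
      (fun y : R => eps%:E * ((y ^+ 2)%:E * (normal_pdf 0 s y)%:E))%E.
    exact: emeasurable_funM.
  have mct : measurable_fun setT
      (fun y : R => (tau / s)%:E * (normal_pdf 0 tau y)%:E)%E.
    exact: emeasurable_funM.
  have msum : measurable_fun setT (fun y : R => (normal_pdf 0 s y)%:E +
      eps%:E * ((y ^+ 2)%:E * (normal_pdf 0 s y)%:E))%E.
    exact: emeasurable_funD.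
  rewrite -[leRHS]ge0_integralZl//; last 2 first.
  - exact: pm.
  - by rewrite lee_fin divr_ge0 ?ltW.
  rewrite -[X in (_ + X)%E]ge0_integralZl//; last by rewrite lee_fin ltW.
  rewrite -ge0_integralD//; last 2 first.
  - exact: pm.
  - by move=> y _; rewrite mule_ge0// lee_fin ltW.
  apply: ge0_le_integral => //.
  - by move=> y _; rewrite adde_ge0// mule_ge0// lee_fin ltW.
  - move=> y _; rewrite lee_fin; apply: le_trans (normal_pdf_sqr_le s tau y s0 st).
    by rewrite mulrDl mul1r mulrA.
case: (m) m0 => [m'| |]//; last first.
  by move=> _; rewrite gt0_muley ?lte_fin.
move=> _; rewrite !lee_fin -tau2 => H.
rewrite -(ler_pM2l eps0).
have -> : eps * tau ^+ 2 = ((tau / s) ^+ 2 - 1) / 2.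
  by rewrite /eps; field; rewrite !gt_eqF.
have := sqr_ge0 (tau / s - 1).
move: (tau / s) (eps * m') H => q em H; nra.
Qed.

Section normal_law.
Context {R : realType}.

(** The centred normal law of standard deviation [s].  As a set function it is
    [normal_prob 0 s], a probability on [measurableTypeR R]; here it is a
    probability on [R] itself, whose measurable structure has the same measurable
    sets and is the one used by [tuple_prod]. *)
Definition normal_law (s : R) : set R -> \bar R := normal_prob 0 s.

HB.instance Definition _ s := isMeasure.Build _ R R (normal_law s)
  (measure0 (normal_prob 0 s)) (measure_ge0 (normal_prob 0 s))
  (@measure_semi_sigma_additive _ _ _ (normal_prob 0 s)).

HB.instance Definition _ s := @Measure_isProbability.Build _ R R (normal_law s)
  (@probability_setT _ _ _ (normal_prob 0 s)).

End normal_law.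

Lemma normal_law_second_moment_le {R : realType} (s : R) : 0 < s ->
  (\int[normal_law s]_y (y ^+ 2)%:E <= (s ^+ 2)%:E)%E.
Proof.
move=> s0; apply: le_trans (normal_prob_second_moment_le s s0).
have mid : measurable_fun setT (id : measurableTypeR R -> R) by [].
have E := @ge0_integral_pushforward _ _ (measurableTypeR R) R R id mid
  (normal_prob 0 s) setT (fun y => (y ^+ 2)%:E) measurableT.
rewrite [leLHS]E//.
- by apply/measurable_EFinP; exact: measurable_funX.
- by move=> y _; rewrite lee_fin sqr_ge0.
Qed.

(** * The laws of the coordinates *)

(** The [k]-th factor of the Green's function of [nu] as a probability: normal
    of variance [2 lambda_k t], or the Dirac mass at [0] when [k] is not in [nu]
    or [lambda_k = 0]. *)
Definition heat_law {R : realType} {N : nat} (lambda : 'I_N -> R) (t : R)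
    (nu : {set 'I_N}) (k : 'I_N) : probability R R :=
  if (k \in nu) && (lambda k != 0)
  then (normal_law (Num.sqrt (2 * lambda k * t)) : probability R R)
  else (dirac (0 : R) : probability R R).

Lemma greenE {R : realType} {N : nat} (nu : {set 'I_N}) (lambda : 'I_N -> R) (t : R) :
  0 < t -> (forall k, 0 <= lambda k) ->
  green nu lambda t = tuple_prod (fun k => heat_law lambda t nu k).
Proof.
move=> t0 l0; rewrite /green; congr tuple_prod; apply/funext => k.
by rewrite green_factor_normal// /heat_law; case: ifP.
Qed.

(** The laws for [nu] are images of those for the full index set under scalings by
    [0], [1] or [-1], the sign being immaterial by symmetry. *)
Lemma heat_law_scale {R : realType} {N : nat} (lambda : 'I_N -> R) (t : R)
    (nu : {set 'I_N}) (k : 'I_N) (c : R) (A : set R) :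
  0 < t -> 0 <= lambda k -> `|c| = (k \in nu)%:R -> measurable A ->
  heat_law lambda t nu k A =
  heat_law lambda t [set: 'I_N]%SET k ((fun x => c * x) @^-1` A).
Proof.
move=> t0 l0 cnu mA; rewrite /heat_law inE/=.
have [lk|lk] /= := eqVneq (lambda k) 0; rewrite ?andbF ?andbT/=.
  have [A0|A0] := pselect (A 0); first by rewrite !diracE !mem_set//= mulr0.
  by rewrite !diracE !memNset//= mulr0.
have s0 : Num.sqrt (2 * lambda k * t) != 0.
  by rewrite gt_eqF// sqrtr_gt0 !mulr_gt0// lt_def lk.
case: ifP cnu => knu /= cnu; last first.
  have -> : c = 0 by apply/eqP; rewrite -normr_eq0 cnu.
  have [A0|A0] := pselect (A 0).
    rewrite diracE mem_set// (_ : _ @^-1` _ = setT) ?probability_setT//.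
    by apply/seteqP; split => x //= _; rewrite mul0r.
  rewrite diracE memNset// (_ : _ @^-1` _ = set0) ?measure0//.
  by apply/seteqP; split => x //=; rewrite mul0r.
have /eqP := cnu; rewrite eqr_norml ler01 andbT => /orP[]/eqP->.
  by congr (normal_prob _ _ _); apply/seteqP; split => x /=; rewrite mul1r.
rewrite -[LHS](normal_prob_opp _ _ s0 mA); congr (normal_prob _ _ _).
by apply/seteqP; split => x /=; rewrite mulN1r.
Qed.

Lemma heat_law_second_moment {R : realType} {N : nat} (lambda : 'I_N -> R) (t : R)
    (nu : {set 'I_N}) (k : 'I_N) : 0 < t -> 0 <= lambda k ->
  (\int[heat_law lambda t nu k]_x (x ^+ 2)%:E <= (2 * lambda k * t)%:E)%E.
Proof.
move=> t0 l0; rewrite /heat_law; case: ifPn => [/andP[_ lk]|_].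
  have s0 : 0 < 2 * lambda k * t by rewrite !mulr_gt0// lt_def lk.
  rewrite -[in leRHS](sqr_sqrtr (ltW s0)).
  by apply: normal_law_second_moment_le; rewrite sqrtr_gt0.
rewrite integral_dirac//; last by apply/measurable_EFinP; exact: measurable_funX.
by rewrite expr0n/= mule0 lee_fin !mulr_ge0// ltW.
Qed.

(** * Measurability of continuous functions on R^n *)

(** The preimage of an open set is a countable union of cubes with rational centres
    and sides, so it belongs to the product sigma-algebra on tuples. *)
Lemma measurable_continuous_row {R : realType} {n : nat} (g : 'rV[R]_n -> R) :
  continuous g ->
  measurable_fun setT (fun y : n.-tuple R => g (\row_k tnth y k)).
Proof.
move=> /continuousP cg.
apply: (measurability _ (RGenOpens.measurableE R)).
move=> _ [_ [a [b ->] <-]]; rewrite setTI.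
have oO : open (g @^-1` `]a, b[) by exact/cg/interval_open.
set O := g @^-1` _ in oO.
pose box (p : {ffun 'I_n -> rat} * nat) : set (n.-tuple R) :=
  [set y | forall k, `|ratr (p.1 k) - tnth y k| < p.2.+1%:R^-1].
have mbox p : measurable (box p).
  rewrite (_ : box p = \big[setI/setT]_(k < n)
      ((fun y => tnth y k) @^-1` ball (ratr (p.1 k) : R) p.2.+1%:R^-1)).
    apply: bigsetI_measurable => k _; rewrite -[X in measurable X]setTI.
    by apply: measurable_tnth => //; exact: measurable_ball.
  rewrite -bigcap_seq; apply/seteqP; split => y /= h k => [_|]; first exact: h.
  by apply: h; rewrite /= mem_index_enum.
pose F p := if `[< box p `<=` (fun y => g (\row_k tnth y k)) @^-1` `]a, b[ >]
  then box p else set0.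
rewrite [X in measurable X](_ : _ = \bigcup_p F p).
  apply: countable_bigcupT_measurable; first exact: countableP.
  by move=> p; rewrite /F; case: ifP.
apply/seteqP; split => y /=; last first.
  by move=> [p _]; rewrite /F; case: ifP => // /asboolP h /h.
move=> gy.
have : nbhs (\row_k tnth y k : 'rV[R]_n) O by exact: open_nbhs_nbhs.
move=> /nbhs_ballP[e /= e0 eO].
have [m me] : exists m : nat, m.+1%:R^-1 < e / 2.
  have e20 : 0 < e / 2 by rewrite divr_gt0.
  (* [2 / (m + 1) < e], so that a cube of half-side [1 / (m + 1)] containing [y] lies
     in the ball of radius [e] around it. *)
  exists (Num.truncn (e / 2)^-1).
  by rewrite invf_plt ?posrE// truncnS_gt.
have d0 : 0 < (m.+1%:R : R)^-1 by rewrite invr_gt0.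
have qP k : exists q : rat, `|ratr q - tnth y k| < m.+1%:R^-1.
  have [|q] := @rat_in_itvoo R (tnth y k) (tnth y k + m.+1%:R^-1).
    by rewrite ltrDl.
  by rewrite in_itv/= => /andP[q1 q2]; exists q; rewrite gtr0_norm ?subr_gt0// ltrBlDl.
pose p := ([ffun k => sval (cid (qP k))] : {ffun 'I_n -> rat}, m).
have yp : box p y by move=> k /=; rewrite ffunE; case: cid.
exists p => //; rewrite /F; case: ifPn => // /asboolP; apply: contra_notP => _.
move=> w wp; apply: eO; split => // i j; rewrite !mxE.
rewrite -ball_normE /= (splitr e).
rewrite (_ : _ - _ = (ratr (p.1 j) - tnth w j) - (ratr (p.1 j) - tnth y j)); last by ring.
apply: le_lt_trans (ler_normB _ _) _.
by rewrite ltrD// (lt_trans _ me).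
Qed.

(** * Bound on a mixed difference of solutions *)

Lemma integrable_Rintegral_lincomb {d} {T : measurableType d} {R : realType}
    (mu : {measure set T -> \bar R}) {I : Type} (s : seq I) (a : I -> R)
    (f : I -> T -> R) :
  (forall i, mu.-integrable setT (EFin \o f i)) ->
  mu.-integrable setT (EFin \o (fun x => \sum_(i <- s) a i * f i x)) /\
  \int[mu]_x (\sum_(i <- s) a i * f i x) = \sum_(i <- s) a i * \int[mu]_x f i x.
Proof.
move=> fi; elim: s => [|i s [IHi IHe]].
  under eq_Rintegral do rewrite big_nil.
  rewrite big_nil /Rintegral integral0; split => //.
  rewrite (_ : EFin \o _ = cst 0%E); first exact: integrable0.
  by apply/funext => x /=; rewrite big_nil.
have ai : mu.-integrable setT (EFin \o (fun x => a i * f i x)).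
  rewrite (_ : EFin \o _ = (fun x => (a i)%:E * (EFin \o f i) x)%E).
    exact: integrableZl.
  by apply/funext => x /=; rewrite EFinM.
split.
  rewrite (_ : EFin \o _ = ((EFin \o (fun x => a i * f i x)%R) \+
    (EFin \o (fun x => \sum_(i <- s) a i * f i x)%R))%E).
    exact: integrableD.
  by apply/funext => x /=; rewrite big_cons.
under eq_Rintegral do rewrite big_cons.
by rewrite RintegralD// RintegralZl// IHe big_cons.
Qed.

Section mixed_difference.
Context {R : realType} {N : nat}.
Context (lambda : 'I_N -> R) (g : 'rV[R]_N -> R) (t : R).
Context (t0 : 0 < t) (l0 : forall k, 0 <= lambda k).
Context (gbc : bounded_continuous g).

Let F z (y : N.-tuple R) := g (z - \row_k tnth y k).

Let mF z : measurable_fun setT (F z).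
Proof.
apply: (measurable_continuous_row (fun w => g (z - w))) => w.
apply: (@continuous_comp _ _ _ (fun w : 'rV[R]_N => z - w) g); last exact: gbc.1.
by apply: continuousB => //; exact: cst_continuous.
Qed.

(** Multiplication of the [k]-th coordinate by [c k]. *)
Let scale (c : 'I_N -> R) (y : N.-tuple R) := [tuple c k * tnth y k | k < N].

Let mscale c : measurable_fun setT (scale c).
Proof.
by apply: (measurable_tuple_map (fun k x => c k * x)) => k; exact: measurable_funM.
Qed.

Context (Q : probability (N.-tuple R) R).
Context (QE : tuple_prod (heat_law lambda t [set: 'I_N]%SET) = Q).

(** All the solutions are integrals against the same measure [Q]. *)
Lemma heat_sol_scale (nu : {set 'I_N}) (c : 'I_N -> R) z :
  (forall k, `|c k| = (k \in nu)%:R) ->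
  heat_sol lambda g nu z t = \int[Q]_y F z (scale c y).
Proof.
move=> cnu; rewrite /heat_sol greenE//.
rewrite (integral_tuple_prod_map (heat_law lambda t [set: 'I_N]%SET) _
  (fun k x => c k * x) (fun y => (F z y)%:E)).
- by rewrite QE.
- by move=> i; exact: measurable_funM.
- by move=> k A mA; exact: heat_law_scale.
- exact/measurable_EFinP.
Qed.

Let iF z c : Q.-integrable setT (EFin \o (fun y => F z (scale c y))).
Proof.
apply: measurable_bounded_integrable => //.
- by rewrite [X in (X < _)%E]probability_setT ltry.
- exact: (measurableT_comp (mF z) (mscale c)).
- have [M [Mr HM]] := gbc.2; exists M; split => // x Mx y _.
  exact: HM.
Qed.

Lemma second_moment2_le (i k : 'I_N) : i != k ->
  (\int[Q]_y (tnth y i ^+ 2 * tnth y k ^+ 2)%:E <=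
   ((2 * lambda i * t) * (2 * lambda k * t))%:E)%E.
Proof.
move=> ik.
pose h (j : 'I_N) (x : R) := if (j == i) || (j == k) then x ^+ 2 else 1.
have mh j : measurable_fun setT (h j).
  by rewrite /h; case: (_ || _); [exact: measurable_funX|exact: measurable_cst].
have h0 j x : 0 <= h j x by rewrite /h; case: (_ || _) => //; exact: sqr_ge0.
have -> : (\int[Q]_y (tnth y i ^+ 2 * tnth y k ^+ 2)%:E =
    \int[Q]_y (\prod_(j < N) h j (tnth y j))%:E)%E.
  apply: eq_integral => y _; congr EFin.
  rewrite (bigD1 i)//= (bigD1 k)/=; last by rewrite eq_sym.
  rewrite big1 ?mulr1 /h ?eqxx ?orbT//= => j /andP[/negbTE-> /negbTE->] //.
have := ge0_integral_tuple_prod_prod (heat_law lambda t [set: 'I_N]%SET) h mh h0.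
rewrite QE => ->.
rewrite (bigD1 i)//= (bigD1 k)/=; last by rewrite eq_sym.
rewrite [X in (_ * (_ * X))%E](_ : _ = 1%E); last first.
  apply: big1 => j /andP[/negbTE ji /negbTE jk].
  under eq_integral do rewrite /h ji jk/=.
  by rewrite integral_cst// mul1e; exact: probability_setT.
rewrite [X in (_ * X)%E]mule1.
rewrite EFinM; apply: lee_pmul.
- by apply: integral_ge0 => x _; rewrite lee_fin.
- by apply: integral_ge0 => x _; rewrite lee_fin.
- by rewrite /h eqxx /=; exact: heat_law_second_moment.
- by rewrite /h eqxx orbT /=; exact: heat_law_second_moment.
Qed.

(** The effect of switching on the diffusion in both coordinates [i] and [k], beyond
    the separate effects of each. *)
Lemma mixed_difference_le (nu : {set 'I_N}) (i k : 'I_N) (M : R) z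
    (U := fun A => heat_sol lambda g A z t) :
  i \notin nu -> k \notin nu -> i != k ->
  pderivable [:: i; i; k; k] g ->
  (forall z, `|pderives [:: i; i; k; k] g z| <= M) ->
  `|U (nu :|: [set i] :|: [set k])%SET - U (nu :|: [set k])%SET
      - U (nu :|: [set i])%SET + U nu| <= t ^+ 2 * (lambda k * lambda i * M).
Proof.
move=> inu knu ik dg gM.
pose c (a b : R) j := if j == k then a else if j == i then b else (j \in nu)%:R.
pose G a b y := F z (scale (c a b) y).
pose w (y : N.-tuple R) := z - \row_j ((j \in nu)%:R * tnth y j).
have GE a b y : G a b y =
    g (w y + (- (a * tnth y k)) *: delta_mx 0 k + (- (b * tnth y i)) *: delta_mx 0 i).
  congr g; apply/rowP => j; rewrite !mxE !tnth_mktuple /c eqxx/=.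
  have [->|jk] := eqVneq j k.
    by rewrite [k == i]eq_sym (negbTE ik) (negbTE knu) /=; ring.
  have [->|ji] := eqVneq j i; first by rewrite (negbTE inu) /=; ring.
  by rewrite /=; ring.
pose D y := second_diff (fun a => second_diff (fun b =>
     g (w y + a *: delta_mx 0 k + b *: delta_mx 0 i)) (tnth y i)) (tnth y k).
(* The nine terms (weight, (a, b)) of the double second difference: the weights are
   the products of those of [1, -2, 1] along [k] and along [i]. *)
pose stencil := [:: (1, (-1, -1)); (-2, (-1, 0)); (1, (-1, 1));
  (-2, (0, -1)); (4, (0, 0)); (-2, (0, 1));
  (1, (1, -1)); (-2, (1, 0)); (1, (1, 1))] : seq (R * (R * R)).
have DE y : D y = \sum_(p <- stencil) p.1 * G p.2.1 p.2.2 y.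
  rewrite !big_cons big_nil/= !GE /D /second_diff !mulN1r !mul0r !mul1r !opprK oppr0.
  by ring.
(* Only [|s|] and [|s'|] matter, so the nine integrals take four values. *)
have UE (a b : bool) (s s' : R) : `|s| = a%:R -> `|s'| = b%:R ->
    \int[Q]_y G s s' y = U [set j | (j \in nu) || (a && (j == k)) || (b && (j == i))]%SET.
  move=> sa sb; rewrite /U (heat_sol_scale _ (c s s'))// => j.
  rewrite !inE /c; have [->|jk] := eqVneq j k.
    by rewrite sa (negbTE knu) eq_sym (negbTE ik) andbF andbT orbF.
  have [->|ji] := eqVneq j i; first by rewrite sb (negbTE inu) andbF andbT.
  by rewrite !andbF !orbF ger0_norm.
have n0 : `|0 : R| = false%:R by rewrite normr0.
have n1 : `|1 : R| = true%:R by rewrite normr1.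
have nN1 : `|-1 : R| = true%:R by rewrite normrN1.
have intD : \int[Q]_y D y = 4 * (U (nu :|: [set i] :|: [set k])%SET
      - U (nu :|: [set k])%SET - U (nu :|: [set i])%SET + U nu).
  under eq_Rintegral do rewrite DE.
  rewrite (integrable_Rintegral_lincomb _ _ _ _ _).2; last by move=> p; exact: iF.
  rewrite !big_cons big_nil/=.
  rewrite (UE true true _ _ nN1 nN1) (UE true false _ _ nN1 n0) (UE true true _ _ nN1 n1).
  rewrite (UE false true _ _ n0 nN1) (UE false false _ _ n0 n0) (UE false true _ _ n0 n1).
  rewrite (UE true true _ _ n1 nN1) (UE true false _ _ n1 n0) (UE true true _ _ n1 n1).
  rewrite (_ : [set j | (j \in nu) || (true && _) || (true && _)]%SET =
      nu :|: [set i] :|: [set k])%SET; last first.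
    by apply/setP => j; rewrite !inE/= orbAC.
  rewrite (_ : [set j | (j \in nu) || (true && _) || (false && _)]%SET =
      nu :|: [set k])%SET; last first.
    by apply/setP => j; rewrite !inE/= orbF.
  rewrite (_ : [set j | (j \in nu) || (false && _) || (true && _)]%SET =
      nu :|: [set i])%SET; last first.
    by apply/setP => j; rewrite !inE/= orbF.
  rewrite (_ : [set j | (j \in nu) || (false && _) || (false && _)]%SET =
      nu)%SET; last first.
    by apply/setP => j; rewrite !inE/= !orbF.
  ring.
have iD : Q.-integrable setT (EFin \o D).
  rewrite (_ : D = fun y => \sum_(p <- stencil) p.1 * G p.2.1 p.2.2 y).
    by apply: (integrable_Rintegral_lincomb _ _ _ _ _).1 => p; exact: iF.
  exact/funext.
have M0 : 0 <= M by apply: le_trans (gM 0).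
have msq (j : 'I_N) : measurable_fun setT (fun y : N.-tuple R => tnth y j ^+ 2).
  by apply: measurable_funX; exact: measurable_tnth.
have mik : measurable_fun setT
    (fun y : N.-tuple R => (tnth y i ^+ 2 * tnth y k ^+ 2)%:E).
  by apply/measurable_EFinP; exact: measurable_funM.
have : (`|\int[Q]_y D y|%:E <= (4 * (t ^+ 2 * (lambda k * lambda i * M)))%:E)%E.
  rewrite EFin_normr_Rintegral//.
  apply: le_trans (le_abse_integral _ _ _) _ => //; first by case/integrableP : iD.
  apply: (@le_trans _ _ (\int[Q]_y (M%:E * (tnth y i ^+ 2 * tnth y k ^+ 2)%:E))%E).
    apply: ge0_le_integral => //.
    - by apply: measurableT_comp => //; case/integrableP : iD.
    - exact: emeasurable_funM.
    - move=> y _; rewrite lee_fin mulrA.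
      exact: second_diff2_le.
  rewrite ge0_integralZl//; last first.
    by move=> y _; rewrite lee_fin mulr_ge0 ?sqr_ge0.
  apply: le_trans (lee_wpmul2l _ (second_moment2_le _ _ ik)) _; first by rewrite lee_fin.
  by rewrite -EFinM lee_fin le_eqVlt; apply/orP; left; apply/eqP; ring.
rewrite lee_fin intD normrM ger0_norm// ler_pM2l//.
Qed.
End mixed_difference.

(** * Telescoping and conclusion *)

Lemma big_ord_nat_interval {R : zmodType} (F : nat -> R) (r n N : nat) :
  (n <= N)%N ->
  \sum_(i < N | (r <= i < n)%N) F i = \sum_(r <= i < n) F i.
Proof.
move=> nN; rewrite big_geq_mkord (big_ord_widen_cond N (fun i => r <= i)%N F)//.
Qed.

(** A purely algebraic identity, valid for any function [U] of the index set. *)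
Lemma telescope_expansion1 {R : comRingType} {N : nat} (U : {set 'I_N} -> R) (r : nat) :
  (r <= N)%N ->
  let lo m := [set j : 'I_N | (j < m)%N]%SET in
  (1 + r%:R - N%:R) * U (lo r) + \sum_(k < N | (r <= k)%N) U (lo r :|: [set k])%SET
    - U [set: 'I_N]%SET =
  - \sum_(k < N) \sum_(i < N | (r <= i < k)%N)
     (U (lo i :|: [set i] :|: [set k])%SET - U (lo i :|: [set k])%SET
      - U (lo i :|: [set i])%SET + U (lo i)).
Proof.
move=> rN lo.
have loS (i : 'I_N) : (lo i :|: [set i] = lo i.+1)%SET.
  by apply/setP => j; rewrite !inE ltnS (leq_eqVlt j) orbC.
have loT : lo N = [set: 'I_N]%SET by apply/setP => j; rewrite !inE ltn_ord.
pose a m := U (lo m).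
pose b k m := U (lo m :|: [set k])%SET.
(* The inner sum telescopes in [i], since [b k k = a k.+1]. *)
transitivity (- \sum_(k < N | (r <= k)%N) ((a k.+1 - a k) - b k r + a r)); last first.
  congr (- _); rewrite big_mkcond; apply: eq_bigr => k _.
  under [RHS]eq_bigr => i _ do rewrite loS.
  rewrite -/(a _) (big_ord_nat_interval
    (fun i => b k i.+1 - b k i - a i.+1 + a i))//; last exact: ltnW.
  have [rk|kr] := leqP r k; last by rewrite big_geq// ltnW.
  transitivity (\sum_(r <= i < k) ((b k i.+1 - b k i) - (a i.+1 - a i))); last first.
    by apply: eq_bigr => i _; ring.
  rewrite sumrB !telescope_sumr//.
  by rewrite [b k k]/b loS -/(a _); ring.
rewrite big_split big_split/= sumrN.
rewrite (_ : \sum_(k < N | (r <= k)%N) (a k.+1 - a k) = a N - a r); last first.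
  by rewrite -(big_geq_mkord r N xpredT (fun k => a k.+1 - a k)) telescope_sumr.
rewrite (_ : \sum_(k < N | (r <= k)%N) a r = a r * (N%:R - r%:R)); last first.
  rewrite -(big_geq_mkord r N xpredT (fun=> a r)) sumr_const_nat -natrB// mulr_natr//.
rewrite /b /a loT; ring.
Qed.

Lemma supnorm_fin_num {R : realType} {N : nat} (f : 'rV[R]_N -> R) :
  [bounded f z | z in [set: 'rV[R]_N]] -> supnorm f \is a fin_num.
Proof.
move=> [M [_ HM]]; have [B MB] : exists B, M < B by exists (M + 1); rewrite ltrDl.
rewrite ge0_fin_numE; last first.
  apply: le_trans (ereal_sup_ubound _); last by exists 0.
  by rewrite lee_fin.
apply: le_lt_trans (ltry B); apply: ge_ereal_sup => _ [z _ <-].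
by rewrite lee_fin; exact: HM.
Qed.

Theorem theorem5 (R : realType) (N r : nat) (lambda : 'I_N -> R)
    (g : 'rV[R]_N -> R) (T t : R) :
  (1 <= N)%N -> (r <= N)%N ->
  (forall i k : 'I_N, (i <= k)%N -> lambda k <= lambda i) ->
  (forall k : 'I_N, 0 <= lambda k) ->
  Cmix 2 2 g ->
  0 < t -> t < T ->
  let u : 'rV[R]_N -> R := fun z => heat_sol lambda g [set: 'I_N]%SET z t in
  (supnorm (fun z : 'rV[R]_N => (expansion1 lambda g r z t - u z)%R)
   <= (t ^+ 2)%:E *
      \sum_(k < N) \sum_(i < N | (r <= i < k)%N)
        (lambda k * lambda i)%:E * supnorm (pderives [:: i; i; k; k] g))%E.
Proof.
move=> _ rN _ l0 [gbc gmix] t0 _; cbv zeta.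
pose M (i k : 'I_N) := fine (supnorm (pderives [:: i; i; k; k] g)).
have mixP (i k : 'I_N) : (i < k)%N -> pderivable [:: i; i; k; k] g /\
    supnorm (pderives [:: i; i; k; k] g) = (M i k)%:E.
  move=> ik; have [] := gmix [tuple i; k]; first by rewrite /= ik.
  by move=> dg [_ bg]; split => //; rewrite /M fineK//; exact: supnorm_fin_num.
have -> : (\sum_(k < N) \sum_(i < N | (r <= i < k)%N)
        (lambda k * lambda i)%:E * supnorm (pderives [:: i; i; k; k] g) =
    (\sum_(k < N) \sum_(i < N | (r <= i < k)%N) (lambda k * lambda i * M i k)%R)%:E)%E.
  rewrite -sumEFin; apply: eq_bigr => k _; rewrite -sumEFin.
  by apply: eq_bigr => i /andP[_ ik]; rewrite (mixP _ _ ik).2.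
apply: ge_ereal_sup => _ [z _ <-]; rewrite -EFinM lee_fin.
rewrite /expansion1 (telescope_expansion1 (fun A => heat_sol lambda g A z t))//.
rewrite normrN mulr_sumr; apply: le_trans (ler_norm_sum _ _ _) _.
apply: ler_sum => k _; rewrite mulr_sumr; apply: le_trans (ler_norm_sum _ _ _) _.
apply: ler_sum => i /andP[_ ik].
have [Q [QE _]] := tuple_prod_box (heat_law lambda t [set: 'I_N]%SET).
have [dg gM] := mixP _ _ ik.
apply: (mixed_difference_le _ _ _ t0 l0 gbc _ QE) => //.
- by rewrite inE ltnn.
- by rewrite inE -leqNgt ltnW.
- by rewrite neq_ltn ik.
- by move=> w; rewrite -lee_fin -gM; apply: ereal_sup_ubound; exists w.
Qed.
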